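(* Let $0<\gamma<1$, $k>0$, let $f$ be nonnegative, non-decreasing and locally Lipschitz on $[0,\infty)$, and let $u_0>0$. Suppose $w^n$ ($0\le n\le N$) is a nonnegative sequence such that $$w^{n}\le u_0+\frac{k^{\gamma}}{\Gamma(1+\gamma)}\sum_{m=0}^{n-1}f(w^{m})\Big((n-m)^{\gamma}-(n-m-1)^{\gamma}\Big),\qquad 0\le n\le N,$$ or $$w^{n}\le u_0+\frac{k^{\gamma}}{\Gamma(\gamma)}\sum_{m=0}^{n-1}f(w^{m})(n-m)^{\gamma-1},\qquad 0\le n\le N.$$ Then $$w^n\le u(nk),\qquad 0\le n\le N,\ n<T_b/k,$$ where $u(t)$ is the unique solution of the fractional ODE $D_c^{\gamma}u=f(u)$ with initial condition $u(0)=u_0$ and interval of existence $[0,T_b)$.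
   Context: Fix $\gamma\in(0,1)$. A function $u\in L^1_{loc}(0,T)$ has right limit $u(0+)=u_0$ at $t=0$ if $\lim_{t\to0+}\frac1t\int_0^t|u(s)-u_0|\,ds=0$. For such $u$, the (generalized) Caputo derivative is the distribution on $(-\infty,T)$ supported in $[0,T)$ given by $D_c^{\gamma}u=g_{-\gamma}*\big((u-u(0+))\theta(t)\big)$, where $\theta$ is the Heaviside function and $g_{-\gamma}=\frac{1}{\Gamma(1-\gamma)}D\big(\theta(t)t^{-\gamma}\big)$ with $D$ the distributional derivative. A strong solution of $D_c^\gamma u=f(u)$, $u(0)=u_0$, is such a $u$ with $u(0+)=u_0$, $D_c^{\gamma}u\in L^1(0,T)$, satisfying the equation almost everywhere. It is known that for continuous $u$ the problem is equivalent to the Volterra equation $u(t)=u_0+\frac{1}{\Gamma(\gamma)}\int_0^t(t-s)^{\gamma-1}f(u(s))\,ds$. Under the hypotheses there is a unique continuous strong solution on a maximal interval $[0,T_b)$, $T_b\in(0,\infty]$, with $\limsup_{t\to T_b^-}u(t)=\infty$ if $T_b<\infty$. Empty sums are zero. *)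

(* Defs.v *)
From HB Require Import structures.
From mathcomp Require Import all_boot all_order all_algebra.
From mathcomp Require Import all_classical all_reals all_analysis.
Set Implicit Arguments.
Unset Strict Implicit.
Unset Printing Implicit Defensive.
Import Order.TTheory GRing.Theory Num.Theory.
Import numFieldNormedType.Exports.
Local Open Scope classical_set_scope.
Local Open Scope ring_scope.

Section caputo.
Context {R : realType}.
Local Notation mu := (@lebesgue_measure R).
Implicit Types (u v f phi : R -> R) (T : R).

Definition Gamma (x : R) : R :=
  \int[mu]_(t in `]0, +oo[) (t `^ (x - 1) * expR (- t)).

Definition heaviside (t : R) : R := \1_(`[0, +oo[ : set R) t.

(* C^oo functions on R whose support is a compact subset of (-oo, T). *)
Definition test_function (T : R) (phi : R -> R) : Prop :=
  (forall n x, derivable (derive1n n phi) x 1) /\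
  exists a b, b < T /\ forall x, phi x != 0 -> a <= x <= b.

(* A distribution is represented by its pairing with test functions; only
   its values on test functions are meaningful. *)
Definition distribution := (R -> R) -> R.

Definition regular_distr (D : set R) (v : R -> R) : distribution :=
  fun phi => \int[mu]_(t in D) (v t * phi t).

Definition distr_deriv (F : distribution) : distribution :=
  fun phi => - F (derive1 phi).

(* <F * v, phi> = <v_t, <F_s, phi (t + s)>>, for F supported in [0, +oo) and v
   a function on D = (-oo, T) with support in [0, T), integrable on [0, b] for
   all b < T. If supp phi is contained in (-oo, b] with b < T, then the inner
   pairing vanishes for t > b, so that the outer integral runs over [0, b]. *)
Definition distr_conv (D : set R) (F : distribution) (v : R -> R) :
    distribution :=
  fun phi => regular_distr D v (fun t => F (fun s => phi (t + s))).

(* g_{-gamma} = Gamma(1 - gamma)^-1 D(theta(t) t^-gamma). *)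
Definition g_neg (gamma : R) : distribution := fun phi =>
  (Gamma (1 - gamma))^-1 *
  distr_deriv (regular_distr setT (fun t => heaviside t * t `^ (- gamma))) phi.

Definition caputo (gamma T u0 : R) (u : R -> R) : distribution :=
  distr_conv `]-oo, T[ (g_neg gamma) (fun t => (u t - u0) * heaviside t).

(* The integral is taken in the extended reals, so that it is +oo when u is not
   integrable near 0. *)
Definition right_limit (u : R -> R) (u0 : R) : Prop :=
  ((t^-1)%:E * \int[mu]_(s in `]0%R, t[) `|u s - u0|%:E)%E @[t --> 0^'+]
    --> 0%E.

(* h is the L^1(0, T) function representing the Caputo derivative. As f is only
   given on [0, +oo), "h = f(u) a.e." includes that u(t) lies in the domain
   of f. *)
Definition strong_solution (gamma : R) (f : R -> R) (u0 T : R) (u : R -> R) :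
    Prop :=
  [/\ locally_integrable `]0, T[ u, right_limit u u0 &
    exists h : R -> R,
    [/\ mu.-integrable `]0, T[ (EFin \o h),
        forall phi, test_function T phi ->
          caputo gamma T u0 u phi = regular_distr `]0, T[ h phi &
        {ae mu, forall t, t \in `]0, T[ -> 0 <= u t /\ h t = f (u t)}]].

(* A solution on [0, Tb), with Tb possibly infinite, is a solution on each
   finite (0, T) with T < Tb: f(u) need not be integrable up to Tb. *)
Definition continuous_strong_solution (gamma : R) (f : R -> R) (u0 : R)
    (Tb : \bar R) (u : R -> R) : Prop :=
  [/\ (0 < Tb)%E,
      {within [set t | 0 <= t /\ (t%:E < Tb)%E], continuous u} &
      forall T : R, 0 < T -> (T%:E < Tb)%E -> strong_solution gamma f u0 T u].

Definition maximal_strong_solution (gamma : R) (f : R -> R) (u0 : R)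
    (Tb : \bar R) (u : R -> R) : Prop :=
  continuous_strong_solution gamma f u0 Tb u /\
  forall (Tb' : \bar R) (v : R -> R),
    (Tb <= Tb')%E -> continuous_strong_solution gamma f u0 Tb' v ->
    (forall t, 0 <= t -> (t%:E < Tb)%E -> v t = u t) -> Tb' = Tb.

End caputo.

(* Main.v *)
Require Import Defs.
From HB Require Import structures.
From mathcomp Require Import all_boot all_order all_algebra.
From mathcomp Require Import all_classical all_reals all_analysis.
From mathcomp Require Import measurable_realfun.
From mathcomp Require Import zify ring lra.
Set Implicit Arguments.
Unset Strict Implicit.
Unset Printing Implicit Defensive.
Import Order.TTheory GRing.Theory Num.Theory.
Import numFieldNormedType.Exports.
Local Open Scope classical_set_scope.
Local Open Scope ring_scope.

(** The solution dominates every sequence satisfying one of the two discrete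
    inequalities because it dominates, in a sense local in time, its own
    Volterra integral.

    Claim: for every j <= N and every time s in [j k, Tb), w_j <= u(s).  Taking
    s = j k gives the theorem, but the claim for all later times is what makes
    the induction on j work, and it spares a proof that u is monotone.  To
    obtain it, write u(s) = u0 + Gamma(gamma)^-1 int_0^s r^(gamma-1) f(u(s-r))
    dr, the delay r being the variable.  If r lies in ((j-m-1) k, (j-m) k) with
    m < j, then s - r >= m k because s >= j k, hence f(u(s-r)) >= f(w_m) by
    induction and monotonicity of f.  Integrating the kernel over these
    intervals gives u(s) >= u0 + k^gamma / Gamma(1+gamma) * sum f(w_m)
    ((j-m)^gamma - (j-m-1)^gamma) >= w_j ([solution_ge_sum]).  The second
    discrete inequality implies the first one, as gamma n^(gamma-1) <=
    n^gamma - (n-1)^gamma ([powR_increment_ge]).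

    Only a lower bound on u is needed, and it is read off directly from the
    distributional equation by choosing the test functions.  Let psi be a
    smooth bump supported in [a, b], 0 <= a < b < T, and let phi be its
    right-sided Riemann-Liouville integral of order gamma,
    phi(t) = Gamma(gamma)^-1 int_0^L r^(gamma-1) psi(t+r) dr.
    Cutting the kernel at L = T makes phi compactly supported and changes
    nothing for t >= 0.  Since g_{-gamma} inverts this fractional integral
    ([g_neg_rl_test]), testing the Caputo derivative against phi yields
    int (u - u0) psi = int f(u) phi ([caputo_rl_test]).  By Tonelli the
    right-hand side is at least (int psi) Gamma(gamma)^-1 int K whenever
    K >= 0 vanishes outside (0, a] and K(r) <= f(u(t)) r^(gamma-1) for all
    t, r with t + r > a ([rl_test_lower]).  Shrinking the bump
    to the right of s bounds u(s) from below, as u is continuous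
    ([solution_ge]).

    That the constants match is the semigroup law of fractional integrals
    together with B(1-gamma, gamma) = Gamma(1-gamma) Gamma(gamma); both are
    instances of one identity, [powk_conv]. *)

(** * Smooth bump functions *)

Section smooth.
Context {R : realType}.
Implicit Types (f g p : R -> R) (x a b : R).

Definition smooth f := forall n x, derivable (derive1n n f) x 1.

(** Smoothness is shown by exhibiting a class of functions that are derivable
    and whose derivatives stay in the class; this avoids closed formulas for
    higher derivatives. *)
Lemma smooth_coind (P : (R -> R) -> Prop) :
  (forall f, P f -> exists2 g, P g & forall x, is_derive x 1 f (g x)) ->
  forall f, P f -> smooth f.
Proof.
move=> step f Pf n.
suff [g [Pg <-]] : exists g, P g /\ g = derive1n n f.
  by have [g' _ dg] := step g Pg => x; apply: ex_derive.
elim: n => [|n [g [Pg gE]]]; first by exists f.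
have [g' Pg' dg] := step g Pg; exists g'; split=> //.
rewrite derive1nS -gE; apply/funext => x.
by rewrite derive1E (@derive_val _ _ _ _ _ _ _ (dg x)).
Qed.

Lemma smooth_derive1 f : smooth f -> smooth (derive1 f).
Proof. by move=> sf n x; have := sf n.+1 x; rewrite /derive1n iterSr. Qed.

Lemma smooth_is_derive f x : smooth f -> is_derive x 1 f ((derive1 f) x).
Proof. by move=> /(_ 0 x) sf; rewrite derive1E; apply/derivableP. Qed.

Lemma smooth_continuous f : smooth f -> continuous f.
Proof.
by move=> sf x; apply/differentiable_continuous/derivable1_diffP/(sf 0).
Qed.

(** The derivatives of the classical flat function exp(-1/x), extended by 0, are
    linear combinations of these. *)
Definition flat n x : R := if 0 < x then x ^- n * expR (- x^-1) else 0.

Lemma flat_ge0 n x : 0 <= flat n x.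
Proof.
by rewrite /flat; case: ifP => // /ltW x0;
  rewrite mulr_ge0 ?expR_ge0// invr_ge0 exprn_ge0.
Qed.

(** From y^(n+2)/(n+2)! <= exp(y) at y = 1/x.  A quadratic bound is what makes
    the derivative at 0 exist and vanish. *)
Lemma flat_le n x : flat n x <= (n.+2)`!%:R * x ^+ 2.
Proof.
rewrite /flat; case: ifPn => x0; last by rewrite mulr_ge0// sqr_ge0.
have xV0 : 0 < x^-1 by rewrite invr_gt0.
rewrite expRN ler_pdivrMr ?expR_gt0//.
have := expR_ge1Dxn n.+1 (ltW xV0) => h.
have {h} h : x^-1 ^+ n.+2 / (n.+2)`!%:R <= expR x^-1.
  by apply: le_trans h; rewrite lerDr.
rewrite -exprVn.
have -> : x^-1 ^+ n = (n.+2)`!%:R * x ^+ 2 * (x^-1 ^+ n.+2 / (n.+2)`!%:R).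
  rewrite -addn2 exprD; field.
  by rewrite (gt_eqF x0) pnatr_eq0 -lt0n fact_gt0.
by rewrite ler_wpM2l// mulr_ge0// sqr_ge0.
Qed.

Lemma is_derive_flat n x :
  is_derive x 1 (flat n) (flat n.+2 x - n%:R * flat n.+1 x).
Proof.
have [x0|x0|->] := ltgtP x 0.
- rewrite {2 3}/flat !ltNge (ltW x0)/= mulr0 subr0.
  suff h : \forall y \near x, cst 0 y = flat n y by apply: near_eq_is_derive h
    _.
  near=> y; rewrite /flat ifF//; apply/negbTE; rewrite -leNgt; apply/ltW.
  by near: y; exact: lt_nbhsl.
- rewrite {2 3}/flat x0.
  have h : \forall y \near x, (y ^+ n)^-1 * expR (- y^-1) = flat n y.
    by near=> y; rewrite /flat ifT//; near: y; exact: lt_nbhsr.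
  apply: near_eq_is_derive h _.
  have xn0 : x ^+ n != 0 by rewrite expf_neq0// gt_eqF.
  have x0' : x != 0 by rewrite gt_eqF.
  have hX : is_derive x 1 (fun y : R => y ^+ n) (n%:R * x ^+ n.-1).
    apply: DeriveDef; first exact: exprn_derivable.
    by rewrite exp_derive /GRing.scale/= mulr1.
  have d1 := @is_deriveV _ (fun y => y ^+ n) x _ 1 xn0 hX.
  have d2 : is_derive x 1 (fun y : R => y^-1) (- x ^- 2 *: 1).
    exact: is_deriveV.
  have d3 : is_derive x 1 (fun y : R => expR (- y^-1)) (expR (- x^-1) * (-
    (- x ^- 2 *: 1))).
    exact: (@is_derive1_comp _ expR (fun y => - y^-1)).
  have := is_deriveM d1 d3 => d4; apply: is_derive_eq d4 _.
  rewrite /GRing.scale/=; case: n xn0 {hX d1} => [|n] xn0.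
    by rewrite !mul0r !mulr0 expr0 invr1; field.
  have zn0 : x ^+ n != 0 by rewrite expf_neq0.
  by rewrite !exprS /=; move: (expR _) (x ^+ n) zn0 => e z z0; field;
    rewrite x0' z0.
rewrite {2 3}/flat ltxx mulr0 subr0.
have dv : h^-1 *: (flat n (h + 0) - flat n 0) @[h --> 0^'] --> (0 : R).
  apply/(@cvgrPdist_le _ R^o) => e e0; near=> h.
  rewrite addr0 {2}/flat ltxx subr0 sub0r normrN /GRing.scale/= normrM normfV.
  have h0 : h != 0 by near: h; exact: nbhs_dnbhs_neq.
  rewrite ler_pdivrMl ?normr_gt0// (ger0_norm (flat_ge0 _ _)).
  rewrite (le_trans (flat_le _ _))// -normr_id -real_normK ?num_real// normr_id
    expr2 mulrA (mulrC `|h|).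
  rewrite ler_wpM2r// -ler_pdivlMl ?ltr0n ?fact_gt0//.
  near: h; apply: dnbhs0_le; by rewrite mulr_gt0// invr_gt0 ltr0n fact_gt0.
apply: DeriveDef.
  apply/cvg_ex; exists 0; under eq_fun do rewrite scaler1; exact: dv.
by rewrite -derive1E; apply/cvg_lim.
Unshelve. all: end_near. Qed.

(** The algebra generated by the factors of a bump on (a, b): it contains the
    bump and, by the Leibniz rule, is stable under derivation. *)
Inductive flat_alg a b : (R -> R) -> Prop :=
| flat_alg_cst k : flat_alg a b (cst k)
| flat_alg_l n : flat_alg a b (fun x => flat n (x - a))
| flat_alg_r n : flat_alg a b (fun x => flat n (b - x))
| flat_algD f g : flat_alg a b f -> flat_alg a b g -> flat_alg a b (f \+ g)
| flat_algM f g : flat_alg a b f -> flat_alg a b g -> flat_alg a b (f \* g).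

Lemma smooth_flat_alg a b f : flat_alg a b f -> smooth f.
Proof.
apply: smooth_coind => {}f; elim=> [k|n|n|{}f g hf [f' Pf' df] hg [g' Pg' dg]
  |{}f g hf [f' Pf' df] hg [g' Pg' dg]].
- by exists (cst 0); [exact: flat_alg_cst|move=> x; exact: is_derive_cst].
- exists ((fun x => flat n.+2 (x - a)) \+ (cst (- n%:R) \* fun x => flat n.+1
  (x - a))).
    by do ?constructor.
  move=> x /=; have := is_derive_flat n (x - a) => d.
  have d' := @is_derive1_comp _ (flat n) (fun y => y - a) x _ 1 d.
  have h : is_derive x 1 (fun y : R => y - a) 1 by apply: is_derive_eq;
    rewrite subr0.
  apply: (is_derive_eq (d' h)).
  by rewrite mulr1 mulNr.
- exists ((cst (-1) \* fun x => flat n.+2 (b - x)) \+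
  (cst n%:R \* fun x => flat n.+1 (b - x))).
    by do ?constructor.
  move=> x /=; have := is_derive_flat n (b - x) => d.
  have d' := @is_derive1_comp _ (flat n) (fun y => b - y) x _ (-1) d.
  have h : is_derive x 1 (fun y : R => b - y) (-1) by apply: is_derive_eq; ring.
  apply: (is_derive_eq (d' h)).
  by ring.
- by exists (f' \+ g'); [constructor|move=> x; exact: is_deriveD].
- exists ((f \* g') \+ (g \* f')); first by do ?constructor.
  by move=> x; apply: is_deriveM.
Qed.

Definition bump a b x : R := flat 0 (x - a) * flat 0 (b - x).

Lemma smooth_bump a b : smooth (bump a b).
Proof.
apply: (@smooth_flat_alg a b).
by apply: (@flat_algM a b (fun x => flat 0 (x - a))); constructor.
Qed.

Lemma bump_ge0 a b x : 0 <= bump a b x.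
Proof. by rewrite mulr_ge0 ?flat_ge0. Qed.

Lemma bump_gt0 a b x : a < x < b -> 0 < bump a b x.
Proof.
move=> /andP[ax xb]; rewrite /bump /flat !subr_gt0 ax xb.
by rewrite !expr0 invr1 !mul1r mulr_gt0// expR_gt0.
Qed.

Lemma bump_neq0 a b x : bump a b x != 0 -> a < x < b.
Proof.
rewrite /bump /flat !subr_gt0; case: ltP => ax; last by rewrite mul0r eqxx.
by case: ltP => // xb; rewrite mulr0 eqxx.
Qed.

End smooth.

(** * Power kernels and the Gamma function *)

Section power_kernels.
Context {R : realType}.
Local Notation mu := (@lebesgue_measure R).
Implicit Types (a b c r s t x y z : R).

Lemma measurable_affine c r : measurable_fun [set: measurableTypeR R]
  (fun x => c * x + r : measurableTypeR R).
Proof. by apply: measurable_funD => //; apply: measurable_funM. Qed.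

(** Lebesgue measure is c times its image under x |-> c x + r: both agree on
    intervals, hence everywhere. *)
Lemma ge0_integral_affine c r (F : R -> \bar R) : 0 < c ->
  measurable_fun setT F -> (forall x, 0 <= F x)%E ->
  (\int[mu]_x F x = c%:E * \int[mu]_x F (c * x + r)%R)%E.
Proof.
move=> c0 mF F0; pose f (x : measurableTypeR R) : measurableTypeR R := c * x +
  r.
have mf : measurable_fun setT f by exact: measurable_affine.
have [pm pmE] : exists pm : {measure set (measurableTypeR R) -> \bar R},
    pm = pushforward mu f :> (set (measurableTypeR R) -> \bar R).
  (* the image measure is a measure because f is measurable *)
  by unshelve refine (ex_intro _ (pushforward mu f : {measure set _ ->
    \bar R}) _).
transitivity (\int[mscale (NngNum (ltW c0)) pm]_x F x)%E.
  apply: eq_measure_integral => A mA _.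
  apply: lebesgue_measure_unique mA => _ [[x y]] _ <-.
  rewrite -[RHS]/(c%:E * pm `]x, y]%classic)%E pmE /pushforward /=.
  have -> : f @^-1` `]x, y]%classic = `](x - r) / c, (y - r) / c]%classic.
    apply/seteqP; split=> z /=;
      rewrite !in_itv/= /f ltr_pdivrMr// ler_pdivlMr// (mulrC z).
      by rewrite ltrBlDr lerBrDr.
    by rewrite ltrBlDr lerBrDr.
  rewrite !lebesgue_measure_itv/= !lte_fin ltr_pM2r ?invr_gt0// ltrD2r.
  case: ifP => xy; last by rewrite mule0.
  by rewrite -!EFinD -EFinM; congr EFin; field; rewrite gt_eqF.
rewrite ge0_integral_mscale//; congr (_ * _)%E.
rewrite -[RHS](@ge0_integral_pushforward _ _ _ _ _ f mf mu setT F)//.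
by apply: eq_measure_integral => A mA _; rewrite pmE.
Qed.

Lemma ge0_integral_scale c (F : R -> \bar R) : 0 < c ->
  measurable_fun setT F -> (forall x, 0 <= F x)%E ->
  (\int[mu]_x F x = c%:E * \int[mu]_x F (c * x)%R)%E.
Proof.
move=> c0 mF F0; rewrite (@ge0_integral_affine c 0)//; congr (_ * _)%E.
by apply: eq_integral => x _; rewrite addr0.
Qed.

Lemma ge0_integral_shift r (F : R -> \bar R) :
  measurable_fun setT F -> (forall x, 0 <= F x)%E ->
  (\int[mu]_x F x = \int[mu]_x F (x + r)%R)%E.
Proof.
move=> mF F0; rewrite (@ge0_integral_affine 1 r)// mul1e.
by apply: eq_integral => x _; rewrite mul1r.
Qed.

Lemma ge0_integralZlR c (f : R -> R) : 0 <= c ->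
  measurable_fun setT f -> (forall x, 0 <= f x) ->
  (c%:E * \int[mu]_x (f x)%:E = \int[mu]_x (c * f x)%:E)%E.
Proof.
move=> c0 mf f0; under [RHS]eq_integral do rewrite EFinM.
rewrite ge0_integralZl_EFin//; last exact/measurable_EFinP.
by move=> x _; rewrite lee_fin.
Qed.

Lemma ge0_integralZrR (K : \bar R) (f : R -> R) : (0 <= K)%E ->
  measurable_fun setT f -> (forall x, 0 <= f x) ->
  ((\int[mu]_x (f x)%:E) * K = \int[mu]_x ((f x)%:E * K))%E.
Proof.
move=> c0 mf f0; rewrite ge0_integralZr//; first exact/measurable_EFinP.
by move=> x _; rewrite lee_fin.
Qed.

(** The kernel s_+^(a-1): extending it by zero to the whole line lets Tonelli
    and the changes of variables be used without tracking domains. *)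
Definition powk a s : R := if 0 < s then s `^ (a - 1) else 0.

Lemma powk_ge0 a s : 0 <= powk a s.
Proof. by rewrite /powk; case: ifP => // _; exact: powR_ge0. Qed.

Lemma powk_gt0 a s : 0 < s -> powk a s = s `^ (a - 1).
Proof. by rewrite /powk => ->. Qed.

Lemma powk_le0 a s : s <= 0 -> powk a s = 0.
Proof. by rewrite /powk leNgt => /negbTE ->. Qed.

Lemma measurable_powk a : measurable_fun setT (powk a).
Proof.
by apply: measurable_fun_ifT => //; apply: measurable_fun_ltr.
Qed.

Lemma powkM a c s : 0 < c -> powk a (c * s) = c `^ (a - 1) * powk a s.
Proof.
move=> c0; have [s0|s0] := leP s 0.
  by rewrite !powk_le0 ?mulr0// pmulr_rle0.
by rewrite !powk_gt0 ?mulr_gt0// powRM// ltW.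
Qed.

(** The Beta function B(a, b), in the form produced by the substitution
    z = r / s; in the form over the unit interval the domain of the inner
    integral would depend on the outer variable. *)
Definition beta_pow a b : \bar R :=
  (\int[mu]_z (powk b z * (1 + z) `^ (- (a + b)))%:E)%E.

Lemma powR_mulB1 a b s : 0 < s ->
  s `^ (a - 1) * s * s `^ (b - 1) = s `^ (a + b - 1).
Proof.
move=> s0; have s0' : s != 0 by rewrite gt_eqF.
rewrite -{2}(powRr1 (ltW s0)) -!powRD ?s0' ?implybT//.
by congr (_ `^ _); ring.
Qed.

(** Substituting r = s z turns the inner variable into a ratio, and then
    y = (1 + z) s in the outer integral separates the variables.  Both changes
    of variables are scalings of the half-line.  With F = exp(-y) this is
    Gamma(a) Gamma(b) = B(a, b) Gamma(a + b); with F a translated test function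
    it is the semigroup law of fractional integrals. *)
Lemma powk_conv a b (F : R -> R) :
  measurable_fun setT F -> (forall x, 0 <= F x) ->
  (\int[mu]_s ((powk a s)%:E * \int[mu]_r (powk b r * F (s + r))%:E) =
   beta_pow a b * \int[mu]_y (powk (a + b) y * F y)%:E)%E.
Proof.
move=> mF F0.
have mpowk := measurable_powk.
pose G (p : measurableTypeR R * measurableTypeR R) : \bar R :=
  (powk (a + b) p.1 * (powk b p.2 * F ((1 + p.2) * p.1)))%:E.
have mG : measurable_fun setT G.
  apply/measurable_EFinP; apply: measurable_funM.
    exact: measurableT_comp (mpowk _) (measurable_fst).
  apply: measurable_funM.
    exact: measurableT_comp (mpowk _) (measurable_snd).
  apply: measurableT_comp => //; apply: measurable_funM => //.
  by apply: measurable_funD.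
have G0 p : (0 <= G p)%E by rewrite lee_fin !mulr_ge0 ?powk_ge0.
transitivity (\int[mu]_s \int[mu]_z G (s, z))%E.
  apply: eq_integral => s _; have [s0|s0] := leP s 0.
    rewrite powk_le0// mul0e integral0_eq// => z _.
    by rewrite /G powk_le0// mul0r.
  rewrite (@ge0_integral_scale s (fun r => (powk b r * F (s + r))%:E))//;
    last 2 first.
    apply/measurable_EFinP; apply: measurable_funM => //.
    by apply: measurableT_comp => //; apply: measurable_funD.
    by move=> x; rewrite lee_fin mulr_ge0 ?powk_ge0.
  rewrite muleA -EFinM ge0_integralZlR//; last 3 first.
  - by rewrite mulr_ge0 ?powk_ge0// ltW.
  - apply: measurable_funM => /=.
      by apply: (measurableT_comp (mpowk b)); apply: measurable_funM.
    by apply: (measurableT_comp mF); apply: measurable_funD.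
  - by move=> z; rewrite mulr_ge0 ?powk_ge0.
  apply: eq_integral => z _; rewrite /G/=; congr EFin.
  rewrite powkM// mulrDl mul1r (mulrC z) !mulrA; do 2 congr (_ * _).
  by rewrite !powk_gt0// powR_mulB1.
(* now s is integrated first, at a fixed ratio z *)
rewrite (fubini_tonelli G mG G0).
transitivity (\int[mu]_z ((powk b z * (1 + z) `^ (- (a + b)))%:E *
    \int[mu]_y (powk (a + b) y * F y)%:E))%E.
  apply: eq_integral => z _; have [z0|z0] := leP z 0.
    rewrite powk_le0// mul0r mul0e integral0_eq// => s _.
    by rewrite /G/= (@powk_le0 b z)// mul0r mulr0.
  have z1 : 0 < 1 + z by rewrite addr_gt0.
  rewrite (@ge0_integral_scale (1 + z) (fun y => (powk (a + b) y * F y)%:E))//;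
    last 2 first.
  - by apply/measurable_EFinP; apply: measurable_funM.
  - by move=> y; rewrite lee_fin mulr_ge0 ?powk_ge0.
  rewrite muleA -EFinM
    (@ge0_integralZlR _ (fun x => powk (a + b) ((1 + z) * x) * F
      ((1 + z) * x))); last 3 first.
  - by rewrite !mulr_ge0 ?powk_ge0 ?powR_ge0// ltW.
  - apply: measurable_funM => /=.
      by apply: (measurableT_comp (mpowk _)); apply: measurable_funM.
    by apply: (measurableT_comp mF); apply: measurable_funM.
  - by move=> y; rewrite mulr_ge0 ?powk_ge0.
  apply: eq_integral => s _; rewrite /G/=; congr EFin.
  rewrite powkM//.
  have h : (1 + z) `^ (- (a + b)) * (1 + z) * (1 + z) `^ (a + b - 1) = 1.
    have := powR_mulB1 (1 - (a + b)) (a + b) z1.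
    by rewrite addrAC subrr add0r subrK subrr powRr0.
  have gen (p q f u v d : R) : u * d * v = 1 ->
    p * (q * f) = q * u * d * (v * p * f).
    by move=> e; rewrite -[LHS]mul1r -e; ring.
  exact: gen.
rewrite -ge0_integralZrR//.
- by apply: integral_ge0 => y _; rewrite lee_fin mulr_ge0 ?powk_ge0.
- apply: measurable_funM => //=.
  apply: (@measurableT_comp _ _ _ _ _ _ (fun y : R => y `^ (- (a + b)))) => //.
  exact: measurable_funD.
- by move=> z; rewrite mulr_ge0 ?powk_ge0 ?powR_ge0.
Qed.

(** The Gamma integral in the extended reals, where products of integrals can be
    rearranged before their finiteness is known. *)
Definition gamma_int a : \bar R := (\int[mu]_s (powk a s * expR (- s))%:E)%E.

Lemma measurable_expRN : measurable_fun setT (fun s : R => expR (- s)).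
Proof. by apply: measurableT_comp => //; exact: measurable_expR. Qed.

Lemma GammaE a : Gamma a = fine (gamma_int a).
Proof.
rewrite /Gamma /Rintegral /gamma_int; congr fine.
rewrite integral_mkcond; apply: eq_integral => s _.
rewrite patchE mem_setE in_itv/= andbT /powk.
by case: ifP => // _; rewrite mul0r.
Qed.

Lemma gamma_int_mul a b :
  (gamma_int a * gamma_int b = beta_pow a b * gamma_int (a + b))%E.
Proof.
have mg c : measurable_fun setT (fun s => powk c s * expR (- s)).
  apply: measurable_funM; first exact: measurable_powk.
  exact: measurable_expRN.
have g0 c s : 0 <= powk c s * expR (- s).
  by rewrite mulr_ge0 ?powk_ge0 ?expR_ge0.
rewrite -powk_conv; [|exact: measurable_expRN|by move=> x; exact: expR_ge0].
rewrite {1}/gamma_int (@ge0_integralZrR _ (fun s => powk a s * expR (- s)));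
  [|by apply: integral_ge0 => s _; rewrite lee_fin|exact: mg|exact: g0].
apply: eq_integral => s _.
rewrite EFinM -muleA {1}/gamma_int (@ge0_integralZlR _
  (fun s => powk b s * expR (- s))); [|exact: expR_ge0|exact: mg|exact: g0].
congr (_ * _)%E.
by apply: eq_integral => r _; rewrite opprD expRD mulrCA.
Qed.

Lemma integral_powR a x y : 0 < a -> 0 < x < y ->
  (\int[mu]_(s in `[x, y]) (s `^ (a - 1))%:E = ((y `^ a - x `^ a) / a)%:E)%E.
Proof.
move=> a0 /andP[x0 xy].
have dP z : 0 < z -> is_derive z 1 (fun s : R => s `^ a / a) (z `^ (a - 1)).
  move=> z0; have d := is_derive1_powR a z0.
  have d' := is_deriveM d (is_derive_cst a^-1 z 1).
  apply: (is_derive_eq d'); rewrite /cst scaler0 add0r /GRing.scale/=.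
  by field; rewrite gt_eqF.
have cF z : 0 < z -> {for z, continuous (fun s : R => s `^ a / a)}.
  move=> z0; apply/differentiable_continuous/derivable1_diffP.
  by have [] := dP z z0.
rewrite (@continuous_FTC2 _ _ (fun s => s `^ a / a))//.
- by rewrite -EFinB -mulrBl.
- apply: continuous_in_subspaceT => z; rewrite inE/= in_itv/= => /andP[xz _].
  apply/differentiable_continuous/derivable1_diffP.
  by apply: derivable_powR; rewrite in_itv/= andbT (lt_le_trans x0).
- split=> [z||].
  + rewrite in_itv/= => /andP[xz _].
    by have [] := dP z (lt_trans x0 xz).
  + by apply: cvg_at_right_filter; apply: cF.
  + by apply: cvg_at_left_filter; apply: cF; exact: lt_trans xy.
- move=> z; rewrite in_itv/= => /andP[xz _].
  by rewrite derive1E; have [_ ->] := dP z (lt_trans x0 xz).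
Qed.

Lemma cvg_powR0 (T : Type) (F : set_system T) (FF : Filter F) (g : T -> R) a :
  0 < a -> (\forall x \near F, 0 <= g x) ->
  g x @[x --> F] --> (0 : R) -> (g x) `^ a @[x --> F] --> (0 : R).
Proof.
move=> a0 g0 gF; apply/(@cvgrPdist_lt _ R^o) => e e0; near=> x.
have gx0 : 0 <= g x by near: x.
rewrite sub0r normrN ger0_norm ?powR_ge0//.
rewrite -[e in _ < e](@powRr1 _ e (ltW e0)) -(mulVf (lt0r_neq0 a0)) powRrM.
apply: gt0_ltr_powR; rewrite ?nnegrE ?powR_ge0//.
near: x; have := gF; move/(@cvgrPdist_lt _ R^o) => /(_ (e `^ a^-1)).
rewrite powR_gt0// => /(_ isT); apply: filterS => x.
by rewrite sub0r normrN => /(le_lt_trans (ler_norm _)).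
Unshelve. all: end_near. Qed.

(** The integral is improper when a < 1: exhaust (0, y] by the intervals
    [y / (i + 2), y], where the primitive is available, and let i grow. *)
Lemma integral_powR0 a y : 0 < a -> 0 < y ->
  (\int[mu]_(s in `]0%R, y[) (s `^ (a - 1))%:E = (y `^ a / a)%:E)%E.
Proof.
move=> a0 y0.
pose F (i : nat) : set R := `[y / i.+2%:R, y]%classic.
have FU : \bigcup_i F i = `]0, y]%classic.
  apply/seteqP; split=> [s [i _]|s]; rewrite /F /= !in_itv/= => /andP[s1 s2].
    by rewrite s2 andbT (lt_le_trans _ s1)// divr_gt0.
  have [n n1] : exists n : nat, y / s < n%:R.
    by exists (Num.truncn (y / s)).+1; rewrite truncnS_gt.
  exists n => //=; rewrite in_itv/= s2 andbT ler_pdivrMr ?ltr0n// mulrC.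
  rewrite -ler_pdivrMr// (le_trans (ltW n1))// ler_nat.
  by do 2 apply: leqW.
have := @ge0_nondecreasing_set_cvg_integral _ (measurableTypeR R) R F
  (fun s => (s `^ (a - 1))%:E) mu.
rewrite FU => /(_ _ _ _ _) h.
have {}h : (\int[mu]_(s in F i) (s `^ (a - 1))%:E @[i --> \oo] -->
    \int[mu]_(s in `]0%R, y]) (s `^ (a - 1))%:E)%E.
  apply: h => //.
  - apply/nondecreasing_seqP => n; rewrite subsetEset /F => s /=.
    rewrite !in_itv/= => /andP[s1 ->]; rewrite andbT (le_trans _ s1)//.
    by rewrite ler_pM2l// lef_pV2 ?posrE ?ltr0n// ler_nat.
  - by move=> i; exact: measurable_itv.
  - by move=> i; apply/measurable_EFinP; exact: measurable_funTS.
  - by move=> i s _; rewrite lee_fin powR_ge0.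
rewrite integral_itv_bndo_bndc; last first.
  by apply/measurable_EFinP; exact: measurable_funTS.
rewrite -(cvg_lim _ h)//; apply/cvg_lim => //.
under eq_fun => i.
  rewrite /F integral_powR//; last first.
    by rewrite divr_gt0//= ltr_pdivrMr ?ltr0n// ltr_pMr// ltr1n.
  over.
apply: cvg_EFin; first by near=> i.
rewrite -[X in _ --> X / a]subr0; apply: cvgMr_tmp; apply: cvgB;
  first exact: cvg_cst.
apply: cvg_powR0 => //; first by near=> i; rewrite divr_ge0// ltW.
rewrite -(mulr0 y); apply: cvgMl_tmp.
have := @cvg_harmonic R; rewrite -(cvg_shiftS (@harmonic R)).
by apply.
Unshelve. all: end_near. Qed.

Lemma powk1 s : powk 1 s = if 0 < s then 1 else 0.
Proof. by rewrite /powk subrr powRr0. Qed.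

Lemma integral_powk1 (g : R -> R) : measurable_fun setT g ->
  (\int[mu]_s (powk 1 s * g s)%:E = \int[mu]_(s in `[0%R, +oo[) (g s)%:E)%E.
Proof.
move=> mg; rewrite -(integral_itv_obnd_cbnd (b := +oo%O)); last first.
  by apply/measurable_EFinP; exact: measurable_funTS.
rewrite [RHS]integral_mkcond; apply: eq_integral => s _.
rewrite patchE mem_setE in_itv/= andbT powk1.
by case: ifP => // _; rewrite (mul1r, mul0r).
Qed.

(** The primitive of (1 + z)^(-a-1) is -(1 + z)^(-a) / a, which vanishes at
    infinity. *)
Lemma beta_pow1 a : 0 < a -> beta_pow a 1 = (a^-1)%:E.
Proof.
move=> a0; rewrite /beta_pow integral_powk1; last first.
  apply: (@measurableT_comp _ _ _ _ _ _ (fun y : R => y `^ (- (a + 1)))) => //.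
  exact: measurable_funD.
have dP z : 0 <= z -> is_derive z 1 (fun s : R => - ((1 + s) `^ (- a) / a))
  ((1 + z) `^ (- (a + 1))).
  move=> z0; have z1 : 0 < 1 + z by rewrite ltr_wpDr.
  have d := is_derive1_powR (- a) z1.
  have h : is_derive z 1 (fun s : R => 1 + s) 1 by apply: is_derive_eq; ring.
  have d0 := @is_derive1_comp _ (powR (R:=R) ^~ (- a))
    (fun s => 1 + s) z _ 1 d h.
  have d' := is_deriveN (is_deriveM d0 (is_derive_cst a^-1 z 1)).
  apply: (is_derive_eq d');
    rewrite /cst scaler0 add0r /GRing.scale/= opprD mulr1.
  by field; rewrite gt_eqF.
have cF z : 0 <= z -> {for z, continuous (fun s : R => - ((1 + s) `^
  (- a) / a))}.
  move=> z0; apply/differentiable_continuous/derivable1_diffP.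
  by have [] := dP z z0.
rewrite (@ge0_continuous_FTC2y _ _ (fun s : R => - ((1 + s) `^
  (- a) / a)) _ 0)//.
- by rewrite addr0 powR1 mul1r EFinN oppeK add0e.
- by move=> x _; exact: powR_ge0.
- apply: continuous_in_subspaceT => z; rewrite inE/= in_itv/= andbT => z0.
  have z1 : 0 < 1 + z by rewrite ltr_wpDr.
  apply: (@continuous_comp _ _ _ (fun s : R => 1 + s) (powR (R:=R) ^~ (-
    (a + 1)))).
    by apply: cvgD; [exact: cvg_cst|exact: cvg_id].
  apply/differentiable_continuous/derivable1_diffP.
  by apply: derivable_powR; rewrite in_itv/= andbT.
- rewrite -oppr0 -(mul0r a^-1); apply: cvgN; apply: cvgMr_tmp.
  under eq_fun do rewrite -mulN1r powRrM.
  apply: cvg_powR0 => //; first by apply: nearW => z; exact: powR_ge0.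
  have zE : \forall z \near +oo%R, (1 + z)^-1 = (1 + z) `^ (-1) :> R.
    have : \forall z \near +oo%R, 0 <= z :> R by apply: nbhs_pinfty_ge;
      rewrite num_real.
    by apply: filterS => z z0; rewrite powR_inv1// addr_ge0.
  apply: cvg_trans; first exact: near_eq_cvg zE.
  apply/gtr0_cvgV0; last by apply: cvg_addrl.
  have : \forall z \near +oo%R, 0 < z :> R by apply: nbhs_pinfty_gt;
    rewrite num_real.
  by apply: filterS => z z0; rewrite addr_gt0.
- by move=> x x0; have [] := dP x (ltW x0).
- by apply: cvg_at_right_filter; apply: cF.
- move=> z; rewrite in_itv/= andbT => z0.
  by rewrite derive1E; have [_ ->] := dP z (ltW z0).
Unshelve. all: end_near. Qed.

Lemma gamma_int1 : gamma_int 1 = 1%E.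
Proof.
rewrite /gamma_int integral_powk1; last exact: measurable_expRN.
rewrite -(@integral_exponential_pdf R 1)// integral_mkcond.
apply: eq_integral => s _; rewrite /exponential_pdf !patchE; case: ifP => // _.
by rewrite mul1r mulN1r.
Qed.

Lemma integral_powR01 a : 0 < a ->
  (\int[mu]_(s in `]0%R, 1%R[) (s `^ (a - 1))%:E = (a^-1)%:E)%E.
Proof. by move=> a0; rewrite integral_powR0// powR1 mul1r. Qed.

Lemma measurable_restrict_EFin (D : set R) (f : R -> R) : measurable D ->
  measurable_fun setT f -> measurable_fun setT ((fun s => (f s)%:E) \_ D).
Proof.
move=> mD mf; apply/(measurable_restrictT (fun s => (f s)%:E)) => //.
by apply/measurable_EFinP; exact: measurable_funTS.
Qed.

Lemma gamma_int_ge a : 0 < a -> ((expR (-1) / a)%:E <= gamma_int a)%E.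
Proof.
move=> a0; rewrite EFinM -integral_powR01//.
rewrite -ge0_integralZl_EFin ?expR_ge0//; last 2 first.
- by move=> s _; rewrite lee_fin powR_ge0.
- by apply/measurable_EFinP; exact: measurable_funTS.
under eq_integral do rewrite -EFinM.
rewrite integral_mkcond; apply: ge0_le_integral => //.
- by move=> x _; apply: erestrict_ge0 => s _;
  rewrite lee_fin mulr_ge0 ?expR_ge0 ?powR_ge0.
- by apply: measurable_restrict_EFin => //; exact: measurable_funM.
- apply/measurable_EFinP; apply: measurable_funM; first exact: measurable_powk.
  exact: measurable_expRN.
move=> s _; rewrite patchE mem_setE in_itv/=; case: ifPn => [/andP[s0 s1]|_].
  by rewrite powk_gt0// lee_fin mulrC ler_wpM2l ?powR_ge0// ler_expR lerN2 ltW.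
by rewrite lee_fin mulr_ge0 ?expR_ge0 ?powk_ge0.
Qed.

(** On (0, 1) drop the exponential; beyond 1 drop the power, which is at
    most 1 there. *)
Lemma gamma_int_le a : 0 < a <= 1 -> (gamma_int a <= (a^-1 + 1)%:E)%E.
Proof.
move=> /andP[a0 a1]; rewrite EFinD -gamma_int1.
rewrite -integral_powR01// integral_mkcond.
have m1 : measurable_fun setT ((fun s : R => (s `^ (a - 1))%:E) \_ `]0%R, 1%R[).
  exact: measurable_restrict_EFin.
have g1 s : (0 <= ((fun s : R => (s `^ (a - 1))%:E) \_ `]0%R, 1%R[) s)%E.
  by apply: erestrict_ge0 => {}s _; rewrite lee_fin powR_ge0.
have m2 c : measurable_fun setT (fun s : R => (powk c s * expR (- s))%:E).
  apply/measurable_EFinP; apply: measurable_funM; first exact: measurable_powk.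
  exact: measurable_expRN.
have g2 c s : (0 <= (powk c s * expR (- s))%:E)%E.
  by rewrite lee_fin mulr_ge0 ?expR_ge0 ?powk_ge0.
apply: (@le_trans _ _ (\int[mu]_s (((fun s : R => (s `^
  (a - 1))%:E) \_ `]0%R, 1%R[) s +
    (powk 1 s * expR (- s))%:E))%E); last first.
  rewrite (@ge0_integralD _ _ R mu setT measurableT)//.
  exact: m2.
apply: ge0_le_integral => //.
- exact: m2.
- by apply: emeasurable_funD => //; exact: m2.
move=> s _; rewrite patchE mem_setE in_itv/=; case: ifPn => [/andP[s0 s1]|].
  rewrite -EFinD lee_fin powk_gt0// ler_wpDr ?mulr_ge0 ?powk_ge0 ?expR_ge0//.
  by rewrite ler_piMr ?powR_ge0// -expR0 ler_expR oppr_le0 ltW.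
have [s0|s0 /=] := leP s 0; first by rewrite !powk_le0// !mul0r add0e.
rewrite -leNgt => s1; rewrite add0e lee_fin ler_wpM2r ?expR_ge0//.
rewrite !powk_gt0// subrr powRr0 -[X in _ <= X](powRr0 s) ler_powR//.
by rewrite subr_le0.
Qed.

Lemma gamma_int_fin_num a : 0 < a <= 1 -> gamma_int a \is a fin_num.
Proof.
move=> a01; rewrite ge0_fin_numE.
  by rewrite (le_lt_trans (gamma_int_le a01))// ltry.
by apply: integral_ge0 => s _; rewrite lee_fin mulr_ge0 ?expR_ge0 ?powk_ge0.
Qed.

Lemma Gamma_gt0 a : 0 < a <= 1 -> 0 < Gamma a.
Proof.
move=> a01; have /andP[a0 _] := a01.
rewrite GammaE -lte_fin fineK ?gamma_int_fin_num//.
by apply: lt_le_trans (gamma_int_ge a0); rewrite lte_fin divr_gt0 ?expR_gt0.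
Qed.

(** The case b = 1 of the Beta-Gamma identity, as B(a, 1) = 1 / a. *)
Lemma GammaS a : 0 < a <= 1 -> Gamma (1 + a) = a * Gamma a.
Proof.
move=> a01; have /andP[a0 _] := a01.
rewrite !GammaE (addrC 1 a).
have : (a%:E * gamma_int a = gamma_int (a + 1))%E.
  have := gamma_int_mul a 1; rewrite gamma_int1 mule1 beta_pow1// => ->.
  by rewrite muleA -EFinM mulfV ?mul1e// gt_eqF.
move=> <-; rewrite fineM//; exact: gamma_int_fin_num.
Qed.

Lemma beta_pow_onem a : 0 < a -> a < 1 ->
  beta_pow (1 - a) a = (Gamma (1 - a) * Gamma a)%:E.
Proof.
move=> a0 a1; have := gamma_int_mul (1 - a) a.
rewrite subrK gamma_int1 mule1 => <-.
rewrite EFinM !GammaE !fineK//; apply: gamma_int_fin_num.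
  by rewrite a0 ltW.
by rewrite subr_gt0 a1 lerBlDr lerDl ltW.
Qed.

End power_kernels.

(** * Truncated fractional integrals as test functions *)

Section fractional_integral.
Context {R : realType}.
Local Notation mu := (@lebesgue_measure R).
Implicit Types (a b c r s t x y z L T : R) (p q psi : R -> R).

Definition supported a b p := forall x, p x != 0 -> a <= x <= b.

Lemma supported_derive1 a b p : supported a b p -> supported a b (derive1 p).
Proof.
move=> ps x; apply: contraNT; rewrite negb_and -!ltNge => xab.
suff h : \forall y \near x, cst 0 y = p y.
  by rewrite derive1E -(near_eq_derive _ h) derive_cst.
have p0 y : (y < a) || (b < y) -> p y = 0.
  by apply: contraTeq => /ps; rewrite negb_or -!leNgt.
case/orP: xab => xab.
  by near=> y; rewrite p0//; apply/orP; left; near: y; exact: lt_nbhsl.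
by near=> y; rewrite p0//; apply/orP; right; near: y; exact: lt_nbhsr.
Unshelve. all: end_near. Qed.

Lemma supported_bounded a b p : continuous p -> supported a b p ->
  exists2 M, 0 <= M & forall x, `|p x| <= M.
Proof.
move=> cp ps; have [ab|ba] := leP a b; last first.
  exists 0 => // x; have [->|/ps/andP[ax xb]] := eqVneq (p x) 0;
    first by rewrite normr0.
  by have := le_trans ax xb; rewrite leNgt ba.
have [|c _ cM] := @EVT_max R (fun x => `|p x|) a b ab.
  by apply: continuous_subspaceT => x; apply: cvg_norm; exact: cp.
exists `|p c| => // x; have [->|/ps xab] := eqVneq (p x) 0;
  first by rewrite normr0.
by apply: cM; rewrite in_itv.
Qed.

(** Up to the factor Gamma(al)^-1, the right-sided Riemann-Liouville integral of
    order al of p, with the kernel cut off at L.  The sharp cut does not affect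
    smoothness, since derivatives fall on p, and it makes the support compact:
    the uncut integral of a nonzero p >= 0 never vanishes far to the left. *)
Definition rl_int al L p x := \int[mu]_(r in `]0, L[) (r `^ (al - 1) * p
  (x + r)).

Lemma integrable_powR al L : 0 < al -> 0 < L ->
  mu.-integrable `]0, L[ (fun r => (r `^ (al - 1))%:E).
Proof.
move=> al0 L0; apply/integrableP; split.
  by apply/measurable_EFinP; exact: measurable_funTS.
under eq_integral do rewrite gee0_abs ?lee_fin ?powR_ge0//.
by rewrite integral_powR0// ltry.
Qed.

Lemma measurable_shift p x : continuous p ->
  measurable_fun setT (fun r => p (x + r)).
Proof.
move=> cp; apply: measurableT_comp; first exact: continuous_measurable_fun.
exact: measurable_funD.
Qed.

Lemma integrable_rl al L p a b x : 0 < al -> 0 < L ->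
  continuous p -> supported a b p ->
  mu.-integrable `]0, L[ (EFin \o (fun r => r `^ (al - 1) * p (x + r))).
Proof.
move=> al0 L0 cp ps; have [M M0 pM] := supported_bounded cp ps.
apply: (@le_integrable _ _ _ mu _ _ _ (fun r => M%:E * (r `^
  (al - 1))%:E)%E) => //.
- apply/measurable_EFinP; apply: measurable_funTS; apply: measurable_funM => //.
  exact: measurable_shift.
- move=> r _ /=; rewrite normrM lee_fin normrM mulrC (ger0_norm M0).
  by rewrite ler_wpM2r.
- by apply: integrableZl => //; exact: integrable_powR.
Qed.

(** Differentiation under the integral sign; the derivative of the integrand is
    dominated by a multiple of the integrable kernel. *)
Lemma is_derive_rl_int al L p a b x : 0 < al -> 0 < L ->
  smooth p -> supported a b p ->
  is_derive x 1 (rl_int al L p) (rl_int al L (derive1 p) x).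
Proof.
move=> al0 L0 sp ps.
have cp := smooth_continuous sp.
have sp' := smooth_derive1 sp.
have cp' := smooth_continuous sp'.
have ps' := supported_derive1 ps.
have [M M0 pM] := supported_bounded cp' ps'.
pose f y r := r `^ (al - 1) * p (y + r).
have df y r : is_derive y 1 (f ^~ r) (r `^ (al - 1) * derive1 p (y + r)).
  have d := smooth_is_derive (y + r) sp.
  have h : is_derive y 1 (fun z : R => z + r) 1 by apply: is_derive_eq; ring.
  have d1 := @is_derive1_comp _ p (fun z : R => z + r) y _ 1 d h.
  have d2 := is_deriveM (is_derive_cst (r `^ (al - 1)) y 1) d1.
  by apply: (is_derive_eq d2); rewrite /cst scaler0 addr0 mulr1.
have d1E y r : partial1of2 f y r = r `^ (al - 1) * derive1 p (y + r).
  by rewrite partial1of2E; have [_ ->] := df y r.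
have xI : `]x - 1, x + 1[%classic x by rewrite /= in_itv/= ltrBlDr ltrDl ltr01.
have mI : measurable (`]0, L[%classic : set
  (measurableTypeR R)) by exact: measurable_itv.
have intf y : `]x - 1, x + 1[%classic y -> mu.-integrable `]0, L[ (EFin \o f y).
  by move=> _; exact: integrable_rl ps.
have derf y r : `]x - 1, x + 1[%classic y -> `]0, L[%classic r ->
  derivable (f ^~ r) y 1.
  by move=> _ _; have [] := df y r.
pose G r := M * r `^ (al - 1).
have G0 r : 0 <= G r by rewrite mulr_ge0// powR_ge0.
have intG : mu.-integrable `]0, L[ (EFin \o G).
  rewrite (_ : EFin \o G = fun r => (M%:E * (r `^ (al - 1))%:E)%E)//.
  by apply: integrableZl => //; exact: integrable_powR.
have Gub y r : `]x - 1, x + 1[%classic y -> `]0, L[%classic r ->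
  `|partial1of2 f y r| <= G r.
  move=> _ _; rewrite d1E normrM /G mulrC (ger0_norm (powR_ge0 _ _)).
  by rewrite ler_wpM2r ?powR_ge0.
have hd := derivable_under_integral mI xI intf derf G0 intG Gub.
apply: DeriveDef; first exact: hd.
rewrite -derive1E (differentiation_under_integral mI xI intf derf G0 intG Gub).
by apply: eq_Rintegral => r _; rewrite d1E.
Qed.

Lemma supported_rl_int al L p a b : supported a b p ->
  supported (a - L) b (rl_int al L p).
Proof.
move=> ps x; apply: contraNT; rewrite negb_and -!ltNge => xab.
apply/eqP; rewrite /rl_int /Rintegral integral0_eq// => r /=.
rewrite in_itv/= => /andP[r0 rL].
have [->|/ps/andP[h1 h2]] := eqVneq (p (x + r)) 0; first by rewrite mulr0.
by case/orP: xab => h; exfalso; lra.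
Qed.

Lemma smooth_scale_rl_int al L p a b c : 0 < al -> 0 < L ->
  smooth p -> supported a b p -> smooth (fun x => c * rl_int al L p x).
Proof.
move=> al0 L0 sp ps.
pose P f := exists p, [/\ smooth p, supported a b p & f = fun x => c * rl_int
  al L p x].
apply: (@smooth_coind _ P); last by exists p.
move=> _ [q [sq qs ->]]; exists (fun x => c * rl_int al L (derive1 q) x).
  by exists (derive1 q); split=> //;
    [exact: smooth_derive1|exact: supported_derive1].
move=> x; have d := is_derive_rl_int x al0 L0 sq qs.
have d2 := is_deriveM (is_derive_cst c x 1) d.
by apply: (is_derive_eq d2); rewrite /cst scaler0 addr0.
Qed.

Lemma smooth_rl_int al L p a b : 0 < al -> 0 < L ->
  smooth p -> supported a b p -> smooth (rl_int al L p).
Proof.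
move=> al0 L0 sp ps; have := smooth_scale_rl_int (c := 1) al0 L0 sp ps.
by under eq_fun do rewrite mul1r.
Qed.

Lemma rl_int_ge0 al L p x : (forall y, 0 <= p y) -> 0 <= rl_int al L p x.
Proof.
by move=> p0; apply: Rintegral_ge0 => r _; rewrite mulr_ge0 ?powR_ge0.
Qed.

(** When x + L is beyond the support of p, cutting the kernel has no effect. *)
Lemma rl_intE al L p a b x : 0 < al -> 0 < L -> continuous p ->
  supported a b p ->
  b < x + L ->
  ((rl_int al L p x)%:E = \int[mu]_r (powk al r * p (x + r))%:E)%E.
Proof.
move=> al0 L0 cp ps bL.
rewrite /rl_int fineK; last exact: (integrable_fin_num _
  (integrable_rl x al0 L0 cp ps)).
rewrite integral_mkcond; apply: eq_integral => r _.
rewrite patchE mem_setE in_itv/= /powk.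
have [r0 /=|//] := ltP 0 r; last by rewrite mul0r.
have [//|Lr] := ltP r L.
have [->|/ps/andP[h1 h2]] := eqVneq (p (x + r)) 0; first by rewrite mulr0.
by exfalso; lra.
Qed.

(** [powk_conv] applied to F = p(x + .); the condition on L allows the cut
    kernels to be replaced by the full ones. *)
Lemma rl_int_semigroup al be C L p a b x : 0 < al -> 0 < be -> 0 < L ->
  beta_pow al be = C%:E ->
  smooth p -> supported a b p -> (forall y, 0 <= p y) ->
  b < x + L ->
  rl_int al L (rl_int be L p) x = C * rl_int (al + be) L p x.
Proof.
move=> al0 be0 L0 CE sp ps p0 bL.
have cp := smooth_continuous sp.
set q := rl_int be L p.
have sq : smooth q by exact: smooth_rl_int ps.
apply: EFin_inj; rewrite (rl_intE al0 L0 (smooth_continuous sq)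
  (supported_rl_int ps) bL).
rewrite EFinM (rl_intE _ L0 cp ps bL) ?addr_gt0// -CE -powk_conv//; last first.
  exact: measurable_shift.
apply: eq_integral => s _; have [s0|s0] := leP s 0.
  by rewrite powk_le0// mul0r mul0e.
rewrite EFinM /q (rl_intE be0 L0 cp ps); last first.
  by rewrite (lt_trans bL)// ltrD2r ltrDl.
by congr (_ * _)%E; apply: eq_integral => r _; rewrite addrA.
Qed.

Lemma rl_int1_derive1 L p a b x : 0 < L -> smooth p -> supported a b p ->
  b < x + L -> rl_int 1 L (derive1 p) x = - p x.
Proof.
move=> L0 sp ps bL.
have pL : p (x + L) = 0.
  by apply/eqP; apply: contraTT bL => /ps/andP[_]; rewrite -leNgt.
rewrite -[RHS]add0r -pL /rl_int.
transitivity (\int[mu]_(r in `[0, L]) derive1 p (x + r)).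
  rewrite /Rintegral; congr fine.
  rewrite [RHS]integral_itv_bndoo; last first.
    apply/measurable_EFinP; apply: measurable_funTS; apply: measurable_shift.
    exact: (smooth_continuous (smooth_derive1 sp)).
  by apply: eq_integral => r _; rewrite subrr powRr0 mul1r.
have dF r : is_derive r 1 (fun r => p (x + r)) (derive1 p (x + r)).
  have d := smooth_is_derive (x + r) sp.
  have h : is_derive r 1 (fun z : R => x + z) 1 by apply: is_derive_eq; ring.
  by apply: (is_derive_eq (@is_derive1_comp _ p
    (fun z : R => x + z) r _ 1 d h)); rewrite mulr1.
have cF r : {for r, continuous (fun r => p (x + r))}.
  by apply/differentiable_continuous/derivable1_diffP; have [] := dF r.
rewrite /Rintegral (@continuous_FTC2 _ _ (fun r => p (x + r)))//=.
- by rewrite addr0.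
- apply: continuous_subspaceT => r.
  apply: (@continuous_comp _ _ _ (fun s : R => x + s) (derive1 p)).
    by apply: cvgD; [exact: cvg_cst|exact: cvg_id].
  exact: (smooth_continuous (smooth_derive1 sp)).
- split=> [z _||].
  + by have [] := dF z.
  + by apply: cvg_at_right_filter; apply: cF.
  + by apply: cvg_at_left_filter; apply: cF.
- by move=> r _; rewrite derive1E; have [_ ->] := dF r.
Qed.

(** Deriving both sides of the semigroup law of orders 1 - al and al: the
    integral of order 1 of p is a primitive of - p.  This goes through the
    derivative of the law, which is stated for nonnegative functions, because
    the derivative of p changes sign. *)
Lemma rl_int_comp al L p a b x : 0 < al -> al < 1 -> 0 < L ->
  smooth p -> supported a b p -> (forall y, 0 <= p y) -> b < x + L ->
  rl_int (1 - al) L (derive1 (rl_int al L p)) x =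
  - (Gamma (1 - al) * Gamma al * p x).
Proof.
move=> al0 al1 L0 sp ps p0 bL.
have al1' : 0 < 1 - al by rewrite subr_gt0.
pose q := rl_int al L p.
have sq : smooth q by exact: smooth_rl_int ps.
have d1 : is_derive x 1 (rl_int
  (1 - al) L q) _ := is_derive_rl_int x al1' L0 sq (supported_rl_int ps).
have d2 := is_derive_rl_int x ltr01 L0 sp ps.
have d3 := is_deriveM (is_derive_cst (Gamma (1 - al) * Gamma al) x 1) d2.
have h : \forall y \near x, Gamma
  (1 - al) * Gamma al * rl_int 1 L p y = rl_int (1 - al) L q y.
  near=> y; rewrite (rl_int_semigroup al1' al0 L0
    (beta_pow_onem al0 al1) sp ps p0) ?subrK//.
  rewrite -ltrBlDr; near: y; apply: lt_nbhsr; by rewrite ltrBlDr.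
have d4 := near_eq_is_derive h d3.
rewrite -[LHS](@derive_val _ _ _ _ _ _ _ d1) (@derive_val _ _ _ _ _ _ _ d4).
by rewrite /cst scaler0 addr0
  (rl_int1_derive1 L0 sp ps bL) /GRing.scale/= mulrN.
Unshelve. all: end_near. Qed.

Definition rl_test al L p x := (Gamma al)^-1 * rl_int al L p x.

Lemma test_function_rl_test al L T p a b : 0 < al -> 0 < L -> b < T ->
  smooth p -> supported a b p -> test_function T (rl_test al L p).
Proof.
move=> al0 L0 bT sp ps; split; first exact: smooth_scale_rl_int ps.
exists (a - L), b; split=> // x; rewrite mulf_eq0 negb_or => /andP[_].
exact: supported_rl_int.
Qed.

(** On functions vanishing far to the right, g_{-al} acts as the right-sided
    fractional derivative of order al, so it undoes the fractional integral. *)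
Lemma g_neg_rl_test al L p a b t : 0 < al -> al < 1 -> 0 < L ->
  smooth p -> supported a b p -> (forall y, 0 <= p y) -> b < t + L ->
  g_neg al (fun s => rl_test al L p (t + s)) = p t.
Proof.
move=> al0 al1 L0 sp ps p0 bL.
have G1 : 0 < Gamma al by rewrite Gamma_gt0// al0 ltW.
have G2 : 0 < Gamma (1 - al) by apply: Gamma_gt0; lra.
pose q := rl_int al L p.
have sq : smooth q by exact: smooth_rl_int ps.
have qs := supported_derive1 (supported_rl_int ps : supported _ _ q).
have dE s : derive1 (fun s => rl_test al L p (t + s)) s =
  (Gamma al)^-1 * derive1 q (t + s).
  have d := smooth_is_derive (t + s) sq.
  have h : is_derive s 1 (fun z : R => t + z) 1 by apply: is_derive_eq; ring.
  have d1 := @is_derive1_comp _ q (fun z : R => t + z) s _ 1 d h.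
  have d2 := is_deriveM (is_derive_cst (Gamma al)^-1 s 1) d1.
  rewrite derive1E (@derive_val _ _ _ _ _ _ _ d2).
  by rewrite /cst scaler0 addr0 mulr1.
have intE : \int[mu]_s (heaviside s * s `^ (- al) * derive1
  (fun s => rl_test al L p (t + s)) s)
    = (Gamma al)^-1 * rl_int (1 - al) L (derive1 q) t.
  rewrite /rl_int -RintegralZl//; last first.
    apply: integrable_rl qs => //;
      [lra|exact: smooth_continuous (smooth_derive1 sq)].
  rewrite [RHS]Rintegral_mkcond; apply: eq_Rintegral => s _.
  rewrite dE patchE mem_setE in_itv/= /heaviside indicE mem_setE in_itv/= andbT.
  (* at s = 0 the Heaviside function is 1, but 0 `^ (- al) is 0 *)
  have [s0|s0|s0] := ltgtP s 0; rewrite ?mul0r//=; last first.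
    by rewrite s0 powR0 ?oppr_eq0 ?gt_eqF// mulr0 mul0r.
  rewrite mul1r addrAC subrr add0r mulrCA.
  have [//|Ls] := ltP s L.
  have [->|/qs/andP[h1 h2]] := eqVneq (derive1 q (t + s)) 0;
    first by rewrite !mulr0.
  by exfalso; lra.
rewrite /g_neg /distr_deriv /regular_distr intE
  (rl_int_comp al0 al1 L0 sp ps p0 bL).
by field; rewrite !gt_eqF.
Qed.

End fractional_integral.

(** * Lower bounds for the solution and the comparison *)

Section comparison.
Context {R : realType}.
Local Notation mu := (@lebesgue_measure R).
Implicit Types (a b c d r s t x y z T : R) (u h K : R -> R).

Lemma continuous_bump a b : continuous (@bump R a b).
Proof. exact/smooth_continuous/smooth_bump. Qed.

Lemma measurable_bump a b : measurable_fun setT (@bump R a b).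
Proof. by apply: continuous_measurable_fun; exact: continuous_bump. Qed.

Lemma supported_bump a b : supported a b (@bump R a b).
Proof. by move=> x /bump_neq0/andP[ax xb]; rewrite !ltW. Qed.

Lemma bump_out a b x : ~~ (a < x < b) -> bump a b x = 0.
Proof. by move=> h; apply/eqP; apply: contraNT h; exact: bump_neq0. Qed.

Lemma integral_bump_itv a b :
  (\int[mu]_(x in `]a, b[) (bump a b x)%:E = \int[mu]_x (bump a b x)%:E)%E.
Proof.
rewrite integral_mkcond; apply: eq_integral => x _.
by rewrite patchE mem_setE in_itv/=; case: ifPn => // /bump_out ->.
Qed.

Lemma integrable_bump a b : mu.-integrable `]a, b[ (EFin \o bump a b).
Proof.
apply: (@integrableS _ _ _ mu `[a, b]) => //; first exact: subset_itv_oo_cc.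
apply: continuous_compact_integrable; first exact: segment_compact.
by apply: continuous_subspaceT; exact: continuous_bump.
Qed.

Lemma Rintegral_bump a b :
  ((\int[mu]_(x in `]a, b[) bump a b x)%:E = \int[mu]_x (bump a b x)%:E)%E.
Proof.
by rewrite -integral_bump_itv fineK//; apply: integrable_fin_num => //;
  exact: integrable_bump.
Qed.

(** On the middle third of [a, b] the bump is bounded below by its positive
    minimum. *)
Lemma Rintegral_bump_gt0 a b : a < b -> 0 < \int[mu]_(x in `]a, b[) bump a b x.
Proof.
move=> ab; set a' := a + (b - a) / 3; set b' := b - (b - a) / 3.
have [aa' a'b' b'b] : [/\ a < a', a' < b' & b' < b] by rewrite /a' /b'; split;
  lra.
have [|c cab cM] := @EVT_min R (bump a b) a' b' (ltW a'b').
  by apply: continuous_subspaceT; exact: continuous_bump.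
move: cab; rewrite in_itv/= => /andP[ac cb].
have c0 : 0 < bump a b c by apply: bump_gt0; lra.
rewrite -lte_fin Rintegral_bump.
apply: (@lt_le_trans _ _ (\int[mu]_(x in `[a', b']) (bump a b c)%:E)%E).
  rewrite integral_cst//= lebesgue_measure_itv/= lte_fin a'b' -EFinB -EFinM
    lte_fin.
  by rewrite mulr_gt0// subr_gt0.
rewrite integral_mkcond; apply: ge0_le_integral => //.
- by move=> x _; apply: erestrict_ge0 => y _; rewrite lee_fin ltW.
- by apply: measurable_restrict_EFin.
- by apply/measurable_EFinP; exact: measurable_bump.
- move=> x _; rewrite patchE; case: ifPn => [|_];
  last by rewrite lee_fin bump_ge0.
  by rewrite mem_setE => xab; rewrite lee_fin cM.
Qed.

(** The Heaviside factor removes t < 0, and for t >= 0 the support of the bump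
    lies before t + T, so that [g_neg_rl_test] applies with L = T. *)
Lemma caputo_rl_test gamma T (u0 : R) u a b : 0 < gamma -> gamma < 1 ->
  0 <= a -> a < b -> b < T ->
  caputo gamma T u0 u (rl_test gamma T (bump a b)) =
  \int[mu]_(t in `]a, b[) ((u t - u0) * bump a b t).
Proof.
move=> g0 g1 a0 ab bT; rewrite /caputo /distr_conv /regular_distr.
rewrite Rintegral_mkcond [RHS]Rintegral_mkcond; apply: eq_Rintegral => t _.
rewrite !patchE !mem_setE !in_itv/= /heaviside indicE mem_setE in_itv/= andbT.
have T0 : 0 < T by lra.
have [t0|t0] := ltP t 0.
  rewrite mulr0 mul0r if_same; case: ifPn => // /andP[at0 _].
  by exfalso; lra.
rewrite mulr1 (g_neg_rl_test g0 g1 T0 (@smooth_bump R a b)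
  (@supported_bump a b) (@bump_ge0 R a b)); last lra.
case: ifPn => tT; case: ifPn => tab //.
  by rewrite (bump_out tab) mulr0.
by exfalso; move: tab; rewrite -leNgt in tT => /andP[]; lra.
Qed.

Lemma measurable_rl_test al L a b : 0 < al -> 0 < L ->
  measurable_fun setT (rl_test al L (@bump R a b)).
Proof.
move=> al0 L0; apply: continuous_measurable_fun; apply: smooth_continuous.
exact: (smooth_scale_rl_int (c := (Gamma al)^-1) al0 L0 (@smooth_bump R a b)
  (@supported_bump a b)).
Qed.

Lemma integrable_rl_test al L T a b h : 0 < al -> 0 < L ->
  mu.-integrable `]0, T[ (EFin \o h) ->
  mu.-integrable `]0, T[ (EFin \o (fun t => h t * rl_test al L (bump a b) t)).
Proof.
move=> al0 L0 ih.
have sp := smooth_scale_rl_int (c := (Gamma al)^-1) al0 L0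
  (@smooth_bump R a b) (@supported_bump a b).
have ps : supported (a - L) b (rl_test al L (bump a b)).
  move=> x; rewrite mulf_eq0 negb_or => /andP[_].
  by apply: supported_rl_int; exact: supported_bump.
have [M M0 pM] := supported_bounded (smooth_continuous sp) ps.
rewrite (_ : EFin \o _ = (EFin \o h) \* (EFin \o rl_test al L (bump a b)))%E;
  last first.
  by apply/funext => t /=; rewrite EFinM.
apply: integrableMl => //.
  by apply: measurable_funTS; exact: measurable_rl_test.
exists M; split; first by rewrite ger0_real.
by move=> y My x _ /=; rewrite (le_trans (pM x))// ltW.
Qed.

Lemma ae_impl (P Q : R -> Prop) : (forall t, P t -> Q t) ->
  {ae mu, forall t, P t} -> {ae mu, forall t, Q t}.
Proof.
move=> PQ [N [mN N0 NP]]; exists N; split=> // t nQ.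
by apply: NP => /PQ.
Qed.

(** K is a lower bound for the integrand of the Volterra integral as a function
    of the delay r, valid whenever t + r > a.
    Integrating K(r) psi(t + r) first over t gives the factor int psi whatever r
    is, because for r <= a the support of psi(. + r) stays inside (0, T). *)
Lemma rl_test_lower gamma T a b h K : 0 < gamma -> gamma <= 1 ->
  0 <= a -> a < b -> b < T ->
  mu.-integrable `]0, T[ (EFin \o h) ->
  measurable_fun setT K -> (forall r, 0 <= K r) ->
  (forall r, K r != 0 -> 0 < r <= a) ->
  {ae mu, forall t, t \in `]0, T[ ->
    0 <= h t /\ forall r, 0 < r -> a < t + r ->
      K r <= h t * r `^ (gamma - 1)} ->
  (((Gamma gamma)^-1)%:E * ((\int[mu]_r (K r)%:E) * \int[mu]_t
    (bump a b t)%:E) <=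
   (\int[mu]_(t in `]0%R, T[) (h t * rl_test gamma T (bump a b) t))%:E)%E.
Proof.
move=> g0 g1 a0 ab bT ih mK K0 Ka hK.
have T0 : 0 < T by lra.
have Gg : 0 < Gamma gamma by rewrite Gamma_gt0// g0.
have G0 : 0 <= (Gamma gamma)^-1 by rewrite invr_ge0 ltW.
set p := bump a b.
have cp : continuous p by exact: continuous_bump.
have mp : measurable_fun setT p by exact: continuous_measurable_fun.
have p0 t : 0 <= p t by exact: bump_ge0.
pose phi := rl_test gamma T p.
have mphi : measurable_fun setT phi by exact: measurable_rl_test.
have mh : measurable_fun `]0, T[ h by apply/measurable_EFinP;
  case/integrableP: ih.
have phi0 t : 0 <= phi t by rewrite mulr_ge0// rl_int_ge0.
rewrite fineK; last first.
  by apply: integrable_fin_num => //; exact: integrable_rl_test.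
pose X t : \bar R := (\int[mu]_r (K r * p (t + r))%:E)%E.
pose G (q : measurableTypeR R * measurableTypeR R) : \bar R := (K q.2 * p
  (q.1 + q.2))%:E.
have mG : measurable_fun setT G.
  apply/measurable_EFinP; apply: measurable_funM.
    exact: measurableT_comp mK (measurable_snd).
  by apply: measurableT_comp => //; apply: measurable_funD.
have G0' q : (0 <= G q)%E by rewrite lee_fin mulr_ge0.
have mX : measurable_fun setT X.
  exact: (measurable_fun_fubini_tonelli_F (m2 := mu) G mG G0').
have X0 t : (0 <= X t)%E by apply: integral_ge0 => r _;
  rewrite lee_fin mulr_ge0.
have XT : (\int[mu]_(t in `]0%R, T[) X t =
    (\int[mu]_r (K r)%:E) * \int[mu]_t (p t)%:E)%E.
  transitivity (\int[mu]_t X t)%E.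
    rewrite integral_mkcond; apply: eq_integral => t _.
    rewrite patchE mem_setE in_itv/=; case: ifPn => // t0T.
    rewrite /X integral0_eq// => r _.
    have [->|/Ka/andP[r0 ra]] := eqVneq (K r) 0; first by rewrite mul0r.
    rewrite /p bump_out ?mulr0//; apply: contra t0T => /andP[h1 h2].
    by apply/andP; split; lra.
  rewrite [LHS](fubini_tonelli G mG G0').
  rewrite ge0_integralZrR//; last by apply: integral_ge0 => t _;
    rewrite lee_fin.
  apply: eq_integral => r _.
  rewrite (@ge0_integral_shift _ r (fun t => (p t)%:E))//; last first.
    exact/measurable_EFinP.
  rewrite (@ge0_integralZlR _ _ (fun t => p (t + r)))//.
  by apply: measurableT_comp => //; apply: measurable_funD.
rewrite -XT -ge0_integralZl_EFin//; last exact: measurable_funTS.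
(* h is nonnegative only almost everywhere *)
rewrite [leRHS](_ : (_ = \int[mu]_(x in `]0%R, T[) (`|h x| * phi x)%:E)%E);
  last first.
  apply: ae_eq_integral => //.
  - apply/measurable_EFinP; apply: measurable_funM => //;
    exact: measurable_funTS.
  - apply/measurable_EFinP; apply: measurable_funM;
    last exact: measurable_funTS.
    exact: measurableT_comp.
  - apply: ae_impl hK => t ht tT.
    by rewrite ger0_norm//; exact: (ht tT).1.
apply: ae_ge0_le_integral => //.
- by move=> t _; rewrite mule_ge0// lee_fin.
- by apply: emeasurable_funM => //; exact: measurable_funTS.
- by move=> t _; rewrite lee_fin mulr_ge0.
- apply/measurable_EFinP; apply: measurable_funM; last exact: measurable_funTS.
  exact: measurableT_comp.
apply: ae_impl hK => t ht tT.
have [ht0 hKt] := ht tT.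
move: tT; rewrite /= in_itv/= => /andP[t0 tT].
rewrite ger0_norm// /phi /rl_test mulrCA
  [in leRHS]EFinM lee_pmul2l ?lte_fin ?invr_gt0//.
rewrite EFinM (rl_intE g0 T0 cp (@supported_bump a b)); last lra.
rewrite (@ge0_integralZlR _ _ (fun r => powk gamma r * p (t + r)))//;
  last 2 first.
- apply: measurable_funM; [exact: measurable_powk|exact: measurable_shift].
- by move=> r; rewrite mulr_ge0 ?powk_ge0.
apply: ge0_le_integral => //.
- by move=> r _; rewrite lee_fin mulr_ge0.
- apply/measurable_EFinP; apply: measurable_funM => //; exact: measurable_shift.
- apply/measurable_EFinP; apply: measurable_funM => //; apply: measurable_funM.
    exact: measurable_powk.
  exact: measurable_shift.
move=> r _; rewrite lee_fin mulrA.
have [->|pn0] := eqVneq (p (t + r)) 0; first by rewrite !mulr0.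
have [K0r|/Ka/andP[r0 ra]] := eqVneq (K r) 0.
  by rewrite K0r mul0r mulr_ge0// mulr_ge0// powk_ge0.
rewrite ler_wpM2r// powk_gt0// hKt//.
by have /andP[] := bump_neq0 pn0.
Qed.

Lemma integral_powR_itv al x y : 0 < al -> 0 <= x -> x < y ->
  (\int[mu]_(s in `]x, y[) (s `^ (al - 1))%:E =
    ((y `^ al - x `^ al) / al)%:E)%E.
Proof.
move=> al0; rewrite le_eqVlt => /predU1P[<-|x0] xy.
  by rewrite integral_powR0// powR0 ?gt_eqF// subr0.
rewrite -integral_powR ?x0// [RHS]integral_itv_bndoo//.
by apply/measurable_EFinP; exact: measurable_funTS.
Qed.

(** s^(al-1) is nonincreasing, so its integral over (x, y) is at least (y - x)
    times its value at y. *)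
Lemma powR_increment_ge al x y : 0 < al -> al <= 1 -> 0 <= x -> x < y ->
  (y - x) * y `^ (al - 1) <= (y `^ al - x `^ al) / al.
Proof.
move=> al0 al1 x0 xy; have y0 : 0 < y by exact: le_lt_trans xy.
rewrite -lee_fin -integral_powR_itv//.
apply: (@le_trans _ _ (\int[mu]_(s in `]x, y[) (y `^ (al - 1))%:E)%E).
  by rewrite integral_cst//= lebesgue_measure_itv/= lte_fin xy -EFinB -EFinM
    mulrC.
apply: ge0_le_integral => //.
- by move=> s _; rewrite lee_fin powR_ge0.
- by apply/measurable_EFinP; exact: measurable_funTS.
move=> s /=; rewrite in_itv/= => /andP[xs sy]; rewrite lee_fin.
have s0 : 0 < s by exact: le_lt_trans xs.
rewrite -(opprB 1 al) !powRN lef_pV2 ?posrE ?powR_gt0//.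
by apply: ge0_ler_powR; rewrite ?nnegrE ?subr_ge0// ltW.
Qed.

(** If u(s) were below the bound, continuity would keep u below some smaller
    value v on a short interval [s, b], and a bump supported there would
    contradict [rl_test_lower]. *)
Lemma solution_ge gamma T (u0 S : R) u (f : R -> R) K c :
  0 < gamma -> gamma < 1 -> 0 <= c ->
  {within `[c, T[, continuous u} ->
  strong_solution gamma f u0 T u ->
  (forall x, 0 <= x -> 0 <= f x) ->
  measurable_fun setT K -> (forall r, 0 <= K r) ->
  (forall r, K r != 0 -> 0 < r <= c) ->
  (forall t r, 0 < t < T -> 0 <= u t -> 0 < r -> c < t + r ->
    K r <= f (u t) * r `^ (gamma - 1)) ->
  (S%:E <= \int[mu]_r (K r)%:E)%E ->
  forall s, c <= s < T -> u0 + S / Gamma gamma <= u s.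
Proof.
move=> g0 g1 c0 cu [_ _ [h [ih hphi hae]]] f0 mK K0 Kc Ku SK s /andP[cs sT].
have Gg : 0 < Gamma gamma by rewrite Gamma_gt0// g0 ltW.
rewrite leNgt; apply/negP => us.
pose v := (u s + (u0 + S / Gamma gamma)) / 2.
have [usv vS] : u s < v /\ v < u0 + S / Gamma gamma by rewrite /v; split; lra.
have [d d0 ud] : exists2 d, 0 < d & forall t, s <= t < s + d -> t < T ->
  u t < v.
  have cus : u t @[t --> within `[c, T[ (nbhs s)] --> u s.
    have := cu s; rewrite /continuous_at nbhs_subspace_in//.
    by rewrite /= in_itv/= cs.
  have /cus : nbhs (u s) [set y | y < v] by exact: lt_nbhsl.
  rewrite nbhs_simpl/= => -[d /= d0 hd]; exists d => // t /andP[st td] tT.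
  apply: hd; last by rewrite /= in_itv/= tT (le_trans cs).
  by rewrite /ball/= distrC ger0_norm ?subr_ge0// ltrBlDl.
pose b := Num.min (s + d / 2) ((s + T) / 2).
have [sb bT bd] : [/\ s < b, b < T & b < s + d].
  by rewrite /b lt_min gt_min gt_min; split; apply/orP || apply/andP; lra.
have s0 : 0 <= s by exact: le_trans cs.
have T0 : 0 < T by exact: le_lt_trans sT.
have cus : {within `[s, b], continuous u}.
  apply: continuous_subspaceW cu => t /=; rewrite !in_itv/= => /andP[st tb].
  by rewrite (le_trans cs)// (le_lt_trans tb).
have test := test_function_rl_test g0 T0 bT (@smooth_bump R s b)
  (@supported_bump s b).
have := hphi _ test; rewrite
  (caputo_rl_test u0 u g0 g1 s0 sb bT) /regular_distr => E.
have := @rl_test_lower gamma T s b h K g0 (ltW g1) s0 sb bT ih mK K0.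
rewrite -E => /(_ _ _) low.
have {}low : (((Gamma gamma)^-1)%:E * ((\int[mu]_r (K r)%:E) * \int[mu]_t
  (bump s b t)%:E) <=
   (\int[mu]_(t in `]s, b[) ((u t - u0) * bump s b t))%:E)%E.
  apply: low => [r /Kc/andP[-> rc]|]; first exact: le_trans cs.
  apply: ae_impl hae => t ht tT; have [ut0 ->] := ht tT.
  split=> [|r r0 str]; first exact: f0.
  apply: Ku => //.
  exact: le_lt_trans str.
set P := \int[mu]_(x in `]s, b[) bump s b x.
have P0 : 0 < P by exact: Rintegral_bump_gt0.
have up : \int[mu]_(t in `]s, b[) ((u t - u0) * bump s b t) <= (v - u0) * P.
  rewrite -RintegralZl//; last exact: integrable_bump.
  apply: le_Rintegral => //.
  - apply: (@integrableS _ _ _ mu `[s, b]) => //; first exact: subset_itv_oo_cc.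
    apply: continuous_compact_integrable; first exact: segment_compact.
    move=> t; apply: cvgM; first by apply: cvgB; [exact: cus|exact: cvg_cst].
    exact: (continuous_subspaceT (@continuous_bump s b)).
  - rewrite (_ : EFin \o _ = fun x => ((v - u0)%:E * (EFin \o bump s b) x)%E)//.
    by apply: integrableZl => //; exact: integrable_bump.
  move=> t /=; rewrite in_itv/= => /andP[st tb].
  rewrite ler_wpM2r ?bump_ge0// lerD2r ltW// ud ?(ltW st)/= ?(lt_trans tb)//.
move: low; rewrite -Rintegral_bump -/P => low.
have {}low : (Gamma gamma)^-1 * (S * P) <= (v - u0) * P.
  rewrite -lee_fin; move: (up); rewrite -lee_fin; apply: le_trans.
  apply: le_trans low; rewrite EFinM; apply: lee_wpmul2l.
    by rewrite lee_fin invr_ge0 ltW.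
  by rewrite EFinM; apply: lee_wpmul2r => //; rewrite lee_fin ltW.
move: low; rewrite mulrA ler_pM2r// mulrC.
by lra.
Qed.

Lemma measurable_powR_itv al x y :
  measurable_fun setT (fun r : R => if x < r < y then r `^ (al - 1) else 0).
Proof.
apply: measurable_fun_ifT => //.
by apply: measurable_and; apply: measurable_fun_ltr.
Qed.

(** The induction step.  K is the function of the delay r equal to
    f(w_m) r^(gamma-1) on ((j-m-1) k, (j-m) k): for a delay in this interval
    the time t = (t + r) - r is at least m k as soon as t + r > j k. *)
Lemma solution_ge_sum gamma T k (u0 : R) u (f : R -> R) (w : nat -> R) j :
  0 < gamma -> gamma < 1 -> 0 < k ->
  {within `[j%:R * k, T[, continuous u} ->
  strong_solution gamma f u0 T u ->
  (forall x, 0 <= x -> 0 <= f x) ->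
  (forall x y, 0 <= x -> x <= y -> f x <= f y) ->
  (forall m, (m < j)%N -> 0 <= w m) ->
  (forall m t, (m < j)%N -> m%:R * k <= t < T -> w m <= u t) ->
  forall s, j%:R * k <= s < T ->
  u0 + k `^ gamma / Gamma (1 + gamma) *
    (\sum_(0 <= m < j) f (w m) * ((j - m)%:R `^ gamma -
      (j - m - 1)%:R `^ gamma)) <= u s.
Proof.
(* the intervals are pairwise disjoint *)
have nat_eq (i m : nat) : (i < j)%N -> (m < j)%N -> (j - m - 1 < j - i)%N ->
    (j - i - 1 < j - m)%N -> i = m by lia.
move=> g0 g1 k0 cu usol f0 fnd w0 wu s sT.
have G1 : Gamma (1 + gamma) = gamma * Gamma gamma by rewrite GammaS// g0 ltW.
have Gg : 0 < Gamma gamma by rewrite Gamma_gt0// g0 ltW.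
pose I (m : nat) r := (j - m - 1)%:R * k < r < (j - m)%:R * k.
pose K r := \sum_(m < j) f (w m) * (if I m r then r `^ (gamma - 1) else 0).
pose S := \sum_(m < j) f (w m) *
  ((((j - m)%:R * k) `^ gamma - ((j - m - 1)%:R * k) `^ gamma) / gamma).
have fw0 (m : 'I_j) : 0 <= f (w m) by exact/f0/w0.
have i0 m r : 0 <= (if I m r then r `^ (gamma - 1) else 0).
  by case: ifP => // _; exact: powR_ge0.
have mi m : measurable_fun setT (fun r => if I m r then r `^
  (gamma - 1) else 0).
  exact: measurable_powR_itv.
have K0 r : 0 <= K r by apply: sumr_ge0 => m _; rewrite mulr_ge0.
have mK : measurable_fun setT K.
  by apply: measurable_sum => m; apply: measurable_funM.
have -> : u0 + k `^ gamma / Gamma (1 + gamma) *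
    (\sum_(0 <= m < j) f (w m) * ((j - m)%:R `^ gamma -
      (j - m - 1)%:R `^ gamma)) =
    u0 + S / Gamma gamma.
  congr (_ + _); rewrite big_mkord G1 /S mulr_sumr mulr_suml;
    apply: eq_bigr => m _.
  rewrite !powRM ?ler0n ?(ltW k0)//.
  by field; rewrite !gt_eqF.
apply: (@solution_ge gamma T u0 S u f K (j%:R * k)) => //.
- by rewrite mulr_ge0// ltW.
- move=> r Kr0; have [m Imr] : exists m : 'I_j, I m r.
    apply: contrapT => nI; move: Kr0; rewrite /K big1 ?eqxx// => m _.
    case: ifPn => [Imr|]; last by rewrite mulr0.
    by exfalso; apply: nI; exists m.
  move: Imr => /andP[h1 h2]; apply/andP; split.
    by apply: le_lt_trans h1; rewrite mulr_ge0// ltW.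
  by rewrite (le_trans (ltW h2))// ler_wpM2r ?(ltW k0)// ler_nat leq_subr.
- move=> t r /andP[t0' tT] ut0 r0 jtr.
  have [[m Imr]|nI] := pselect (exists m : 'I_j, I m r); last first.
    rewrite /K big1 => [|m _]; first by rewrite mulr_ge0 ?powR_ge0// f0.
    case: ifPn => [Imr|]; last by rewrite mulr0.
    by exfalso; apply: nI; exists m.
  have -> : K r = f (w m) * r `^ (gamma - 1).
    rewrite /K (bigD1 m)//= Imr big1 ?addr0// => i im.
    case: ifPn => [Iir|]; last by rewrite mulr0.
    exfalso; move: Imr Iir im => /andP[h1 h2] /andP[h3 h4].
    have := lt_trans h1 h4; rewrite ltr_pM2r// ltr_nat => h5.
    have := lt_trans h3 h2; rewrite ltr_pM2r// ltr_nat => h6.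
    by move=> /eqP; apply; apply/val_inj; exact: nat_eq h5 h6.
  rewrite ler_wpM2r ?powR_ge0// fnd ?w0// wu// tT andbT.
  move: Imr => /andP[_ h2].
  have jE : (j%:R : R) = m%:R + (j - m)%:R by rewrite -natrD subnKC// ltnW.
  by move: jtr; rewrite jE mulrDl; lra.
- rewrite le_eqVlt; apply/orP; left; apply/eqP; rewrite /K /S -sumEFin.
  under [RHS]eq_integral do rewrite -sumEFin.
  rewrite ge0_integral_sum//; last 2 first.
  - move=> m; apply/measurable_EFinP.
    exact: (measurable_funM (measurable_cst _) (mi m)).
  - by move=> m r _; rewrite lee_fin mulr_ge0.
  apply: eq_bigr => m _.
  rewrite -ge0_integralZlR// EFinM; congr (_ * _)%E.
  rewrite -integral_powR_itv//; last 2 first.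
  - by rewrite mulr_ge0// ltW.
  - by rewrite ltr_pM2r// ltr_nat; move: (ltn_ord m); lia.
  rewrite integral_mkcond; apply: eq_integral => r _.
  by rewrite patchE mem_setE in_itv/= /I; case: ifP.
Qed.

End comparison.

Theorem lemma6p1 (R : realType) (gamma k u0 : R) (f : R -> R)
  (gamma_gt0 : 0 < gamma) (gamma_lt1 : gamma < 1) (k_gt0 : 0 < k)
  (f_ge0 : forall x, 0 <= x -> 0 <= f x)
  (f_ndecr : forall x y, 0 <= x -> x <= y -> f x <= f y)
  (f_lip : [locally [lipschitz f x | x in (`[0, +oo[ : set R)]])
  (u0_gt0 : 0 < u0)
  (N : nat) (w : nat -> R)
  (w_ge0 : forall n, (n <= N)%N -> 0 <= w n)
  (w_le :
    (forall n, (n <= N)%N ->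
       w n <= u0 + k `^ gamma / Gamma (1 + gamma) *
         \sum_(0 <= m < n)
           f (w m) * ((n - m)%:R `^ gamma - (n - m - 1)%:R `^ gamma))
    \/
    (forall n, (n <= N)%N ->
       w n <= u0 + k `^ gamma / Gamma gamma *
         \sum_(0 <= m < n) f (w m) * (n - m)%:R `^ (gamma - 1)))
  (u : R -> R) (Tb : \bar R)
  (u_sol : maximal_strong_solution gamma f u0 Tb u) :
  forall n, (n <= N)%N -> (n%:R%:E < Tb / k%:E)%E -> w n <= u (n%:R * k).
Proof.
have [[Tb0 cu usol] _] := u_sol.
have Gg : 0 < Gamma gamma by rewrite Gamma_gt0// gamma_gt0 ltW.
have {}w_le n : (n <= N)%N -> w n <= u0 + k `^ gamma / Gamma (1 + gamma) *
    \sum_(0 <= m < n) f (w m) * ((n - m)%:R `^ gamma - (n - m - 1)%:R `^ gamma).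
  case: w_le => w_le nN; first exact: w_le.
  apply: (le_trans (w_le n nN));
    rewrite lerD2l GammaS ?gamma_gt0 ?(ltW gamma_lt1)//.
  rewrite -!mulrA ler_wpM2l ?powR_ge0// invfM (mulrC gamma^-1) -mulrA.
  rewrite ler_wpM2l ?invr_ge0 ?(ltW Gg)// mulr_sumr !big_mkord.
  apply: ler_sum => m _; rewrite [leRHS]mulrCA ler_wpM2l//.
    by apply: f_ge0; apply: w_ge0; rewrite (leq_trans (ltnW (ltn_ord m))).
  rewrite mulrC; have := @powR_increment_ge R gamma (n - m - 1)%:R
    (n - m)%:R gamma_gt0 (ltW gamma_lt1).
  rewrite ler0n ltr_nat -natrB ?leq_subr// subKn ?subn_gt0//.
  by rewrite mul1r; apply => //; move: (ltn_ord m); lia.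
(* the induction needs w n <= u at all times after n k, not only at n k *)
suff ge_w n : (n <= N)%N -> forall s, n%:R * k <= s -> (s%:E < Tb)%E ->
  w n <= u s.
  move=> n nN; rewrite inver gt_eqF// lte_pdivlMr// -EFinM => nkT.
  exact: ge_w.
elim/ltn_ind: n => n IH nN s nks sTb.
have s0 : 0 <= s by apply: le_trans nks; rewrite mulr_ge0// ltW.
have [T sT TTb] : exists2 T : R, s < T & (T%:E < Tb)%E.
  case: Tb sTb {u_sol Tb0 cu usol IH} => [b| |]//= sTb.
  - by rewrite lte_fin in sTb; exists ((s + b) / 2); rewrite ?lte_fin; lra.
  - by exists (s + 1); rewrite ?ltry// ltrDl.
apply: (le_trans (w_le n nN)).
apply: (@solution_ge_sum _ gamma T k u0 u f w n) => //.
- apply: continuous_subspaceW cu => t /=; rewrite in_itv/= => /andP[nt tT].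
  split; last by apply: lt_trans TTb; rewrite lte_fin.
  by apply: le_trans nt; rewrite mulr_ge0// ltW.
- by apply: usol => //; exact: le_lt_trans sT.
- by move=> m mn; apply: w_ge0; rewrite (leq_trans (ltnW mn)).
- move=> m t mn /andP[mt tT]; apply: (IH m mn) => //.
    by rewrite (leq_trans (ltnW mn)).
  by apply: lt_trans TTb; rewrite lte_fin.
- by rewrite nks.
Qed.
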